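(* Let $R$ be a ring, $S$ a subring of $R$, and let $d_1, d_2 : S \to R$ be derivations with respect to the natural $(S,S)$-bimodule structure on $R$. Then: 1. the set \[ T(S,R) := \left\{ \begin{pmatrix} f & d_1(f) & g\\ 0 & f & d_2(f)\\ 0 & 0 & f\end{pmatrix} \ \Big|\ f \in S,\ g\in R\right\} \subseteq \mathbb{M}_3(R) \] is a subring of $\mathbb{M}_3(R)$; 2. the set \[ \mathfrak{m} = \left\{ \begin{pmatrix} 0 & 0 & g\\ 0 & 0 & 0\\ 0 & 0 & 0\end{pmatrix} \ \Big|\ g\in R\right\} \] is an ideal of $T(S,R)$; 3. $\mathfrak{m}^2 = 0$, and the additive groups of $\mathfrak{m}$ and $R$ are isomorphic; 4. $T(S,R)/\mathfrak{m} \simeq S$ as rings, so $T(S,R)$ is an ideal extension of $\mathfrak{m}$ by $S$.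
   Context: All rings are associative but not necessarily with unity; ideals are two-sided. $\mathbb{M}_3(R)$ is the ring of $3\times 3$ matrices over $R$. A derivation $d : S \to R$ (with $S$ acting on $R$ by left and right multiplication) is a map with $d(x+y) = d(x)+d(y)$ and $d(xy) = x\,d(y) + d(x)\,y$ for all $x,y\in S$. An ideal extension of a ring $I$ by a ring $Q$ is a ring $R$ which contains an ideal $I'$ isomorphic (as a ring) to $I$ such that $R/I' \simeq Q$. *)

(* Defs.v *)
From HB Require Import structures.
From mathcomp Require Import all_boot all_algebra.
From mathcomp Require Import boolp classical_sets.

Set Implicit Arguments.
Unset Strict Implicit.
Unset Printing Implicit Defensive.

Import GRing.Theory.

Local Open Scope classical_set_scope.
Local Open Scope ring_scope.

(* Associative rings, not necessarily with unity (and possibly trivial). *)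
HB.mixin Record Zmodule_isRng R of GRing.Zmodule R := {
  rmul : R -> R -> R;
  rmulA : associative rmul;
  rmulDl : left_distributive rmul +%R;
  rmulDr : right_distributive rmul +%R;
}.

#[short(type="rngType")]
HB.structure Definition Rng := {R of Zmodule_isRng R & GRing.Zmodule R}.

Notation "x ** y" := (rmul x y)
  (at level 40, left associativity) : ring_scope.

Section RngTheory.
Variable R : rngType.
Implicit Types x y z : R.

Lemma rmul0r x : 0 ** x = 0.
Proof. by apply: (addIr (0 ** x)); rewrite -rmulDl !add0r. Qed.

Lemma rmulr0 x : x ** 0 = 0.
Proof. by apply: (addIr (x ** 0)); rewrite -rmulDr !add0r. Qed.

Lemma rmulNr x y : (- x) ** y = - (x ** y).
Proof. by apply: (addIr (x ** y)); rewrite -rmulDl !addNr rmul0r. Qed.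

Lemma rmulrN x y : x ** (- y) = - (x ** y).
Proof. by apply: (addIr (x ** y)); rewrite -rmulDr !addNr rmulr0. Qed.

Lemma rmulBl x y z : (x - y) ** z = x ** z - y ** z.
Proof. by rewrite rmulDl rmulNr. Qed.

Lemma rmulBr x y z : x ** (y - z) = x ** y - x ** z.
Proof. by rewrite rmulDr rmulrN. Qed.

Lemma rmul_suml (I : finType) (F : I -> R) x :
  (\sum_i F i) ** x = \sum_i (F i ** x).
Proof.
apply: (big_morph (fun y => y ** x)); last exact: rmul0r.
by move=> y z; rewrite rmulDl.
Qed.

Lemma rmul_sumr (I : finType) (F : I -> R) x :
  x ** (\sum_i F i) = \sum_i (x ** F i).
Proof.
apply: (big_morph (fun y => x ** y)); last exact: rmulr0.
by move=> y z; rewrite rmulDr.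
Qed.

End RngTheory.

Section MatrixRng.
Variables (R : rngType) (n : nat).
Implicit Types A B C : 'M[R]_n.

Definition rmulmx A B : 'M[R]_n := \matrix_(i, k) \sum_j A i j ** B j k.

Lemma rmulmxA : associative rmulmx.
Proof.
move=> A B C; apply/matrixP => i l; rewrite !mxE.
under eq_bigr do rewrite mxE rmul_sumr.
under [RHS]eq_bigr do rewrite mxE rmul_suml.
rewrite exchange_big /=; apply: eq_bigr => k _.
by apply: eq_bigr => j _; rewrite rmulA.
Qed.

Lemma rmulmxDl : left_distributive rmulmx +%R.
Proof.
move=> A B C; apply/matrixP => i l; rewrite !mxE -big_split /=.
by apply: eq_bigr => j _; rewrite mxE rmulDl.
Qed.

Lemma rmulmxDr : right_distributive rmulmx +%R.
Proof.
move=> A B C; apply/matrixP => i l; rewrite !mxE -big_split /=.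
by apply: eq_bigr => j _; rewrite mxE rmulDr.
Qed.

HB.instance Definition _ :=
  Zmodule_isRng.Build 'M[R]_n rmulmxA rmulmxDl rmulmxDr.

End MatrixRng.

Definition subrng_closed (R : rngType) (A : set R) : Prop :=
  [/\ A 0,
      forall x y, A x -> A y -> A (x - y) &
      forall x y, A x -> A y -> A (x ** y)].

Record subrng (R : rngType) := Subrng {
  subrng_set : set R;
  subrng_setP : subrng_closed subrng_set
}.

Section SubrngTheory.
Variables (R : rngType) (S : subrng R).

Definition subrng_pred : {pred R} := fun x => x \in subrng_set S.

Lemma subrng_pred_closed : zmod_closed subrng_pred.
Proof.
case: (subrng_setP S) => S0 SB _; split; first exact: mem_set.
by move=> x y /set_mem Sx /set_mem Sy; apply/mem_set/SB.
Qed.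

HB.instance Definition _ :=
  GRing.isZmodClosed.Build R subrng_pred subrng_pred_closed.

Definition subrng_sort := {x : R | subrng_pred x}.

HB.instance Definition _ := SubChoice.on subrng_sort.
HB.instance Definition _ := [SubChoice_isSubZmodule of subrng_sort by <:].

Lemma subrng_mul_subproof (x y : subrng_sort) : subrng_pred (val x ** val y).
Proof.
case: (subrng_setP S) => _ _ SM.
by apply/mem_set/SM; apply/set_mem; exact: valP.
Qed.

Definition subrng_mul (x y : subrng_sort) : subrng_sort :=
  Sub (val x ** val y) (subrng_mul_subproof x y).

Lemma subrng_mulA : associative subrng_mul.
Proof. by move=> x y z; apply: val_inj; rewrite /= rmulA. Qed.

Lemma subrng_mulDl : left_distributive subrng_mul +%R.
Proof. by move=> x y z; apply: val_inj; rewrite /= rmulDl. Qed.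

Lemma subrng_mulDr : right_distributive subrng_mul +%R.
Proof. by move=> x y z; apply: val_inj; rewrite /= rmulDr. Qed.

HB.instance Definition _ :=
  Zmodule_isRng.Build subrng_sort subrng_mulA subrng_mulDl subrng_mulDr.

End SubrngTheory.

Coercion subrng_sort : subrng >-> Sortclass.

Definition subrng_val (R : rngType) (S : subrng R) (x : S) : R := val x.

Definition ideal_closed (R : rngType) (I : set R) : Prop :=
  [/\ I 0,
      forall x y, I x -> I y -> I (x - y),
      forall r x, I x -> I (r ** x) &
      forall r x, I x -> I (x ** r)].

Lemma ideal_subrng_closed (R : rngType) (I : set R) :
  ideal_closed I -> subrng_closed I.
Proof. by case=> I0 IB IMl _; split=> // x y _; apply: IMl. Qed.

Record ideal (R : rngType) := Ideal {
  ideal_set : set R;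
  ideal_setP : ideal_closed ideal_set
}.

Coercion ideal_subrng (R : rngType) (I : ideal R) : subrng R :=
  Subrng (ideal_subrng_closed (ideal_setP I)).

Definition ideal_prod (R : rngType) (I J : ideal R) : set R :=
  [set x | exists n (a b : 'I_n -> R),
     [/\ forall i, ideal_set I (a i), forall i, ideal_set J (b i) &
         x = \sum_(i < n) a i ** b i]].

Section RngQuotient.
Variables (R : rngType) (I : ideal R).

Definition rng_quot := Quotient.quot (subrng_pred I).

HB.instance Definition _ := GRing.Zmodule.on rng_quot.

Definition rng_proj (x : R) : rng_quot := (\pi_rng_quot x)%qT.

Definition rng_quot_mul (u v : rng_quot) : rng_quot :=
  rng_proj (repr u ** repr v).

Lemma rng_projK u : rng_proj (repr u) = u.
Proof. exact: reprK. Qed.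

Lemma rng_projP x y : rng_proj x = rng_proj y <-> ideal_set I (x - y).
Proof.
have E := Quotient.idealrBE (subrng_pred I) x y; split.
  by move=> h; apply/set_mem; rewrite -[_ \in _]/(x - y \in subrng_pred I) E; apply/eqP.
by move=> h; apply/eqP; rewrite -[_ == _]E; apply: mem_set.
Qed.

Lemma rng_projD x y : rng_proj (x + y) = rng_proj x + rng_proj y.
Proof. exact: Quotient.pi_add. Qed.

Lemma rng_projM x y : rng_proj (x ** y) = rng_quot_mul (rng_proj x) (rng_proj y).
Proof.
case: (ideal_setP I) => I0 IB IMl IMr; apply/rng_projP.
set x' := repr _; set y' := repr _.
have hx : ideal_set I (x' - x) by apply/rng_projP; rewrite rng_projK.
have hy : ideal_set I (y - y') by apply/rng_projP; rewrite rng_projK.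
have -> : x ** y - x' ** y' = x ** (y - y') - (x' - x) ** y'.
  by rewrite rmulBr rmulBl opprB addrA subrK.
by apply: IB; [exact: IMl | exact: IMr].
Qed.

Lemma rng_quot_mulA : associative rng_quot_mul.
Proof.
move=> x y z; rewrite -[x]rng_projK -[y]rng_projK -[z]rng_projK.
by rewrite -!rng_projM rmulA.
Qed.

Lemma rng_quot_mulDl : left_distributive rng_quot_mul +%R.
Proof.
move=> x y z; rewrite -[x]rng_projK -[y]rng_projK -[z]rng_projK.
by rewrite -!(rng_projD, rng_projM) rmulDl.
Qed.

Lemma rng_quot_mulDr : right_distributive rng_quot_mul +%R.
Proof.
move=> x y z; rewrite -[x]rng_projK -[y]rng_projK -[z]rng_projK.
by rewrite -!(rng_projD, rng_projM) rmulDr.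
Qed.

HB.instance Definition _ :=
  Zmodule_isRng.Build rng_quot rng_quot_mulA rng_quot_mulDl rng_quot_mulDr.

End RngQuotient.

Definition zmod_isom (U V : zmodType) : Prop :=
  exists2 f : U -> V, bijective f & {morph f : x y / x + y}.

Definition rng_isom (U V : rngType) : Prop :=
  exists f : U -> V,
    [/\ bijective f, {morph f : x y / x + y} & {morph f : x y / x ** y}].

(* [E] is an extension of [I] by [Q], in this order of the arguments. *)
Definition ideal_extension (E I Q : rngType) : Prop :=
  exists I' : ideal E, rng_isom I I' /\ rng_isom (rng_quot I') Q.

(* [S] acts on [R] by left and right multiplication in [R]. *)
Definition derivation (R : rngType) (S : subrng R) (d : S -> R) : Prop :=
  {morph d : x y / x + y} /\
  forall x y : S, d (x ** y) = subrng_val x ** d y + d x ** subrng_val y.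

Definition mx3 (R : rngType) (s : seq (seq R)) : 'M[R]_3 :=
  \matrix_(i, j) nth 0 (nth [::] s i) j.

Definition T_set (R : rngType) (S : subrng R) (d1 d2 : S -> R) : set 'M[R]_3 :=
  [set A | exists (f : S) (g : R),
     A = mx3 [:: [:: subrng_val f; d1 f        ; g           ];
                 [:: 0           ; subrng_val f; d2 f        ];
                 [:: 0           ; 0           ; subrng_val f]]].

Definition m_set (R : rngType) : set 'M[R]_3 :=
  [set A | exists g : R,
     A = mx3 [:: [:: 0; 0; g];
                 [:: 0; 0; 0];
                 [:: 0; 0; 0]]].
Arguments m_set R : clear implicits.

(* Main.v *)
(* By the Leibniz rule the entries in positions (1,2) and (2,3) of a product of
   two elements of [T] are [d1] and [d2] of its diagonal entry.  Reading off the
   diagonal entry is therefore a surjective ring morphism from [T] to [S], and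
   its kernel is [m] because [d1 0 = d2 0 = 0]. *)
Require Import Defs.
From HB Require Import structures.
From mathcomp Require Import all_boot all_algebra.
From mathcomp Require Import boolp classical_sets functions.

Set Implicit Arguments.
Unset Strict Implicit.
Unset Printing Implicit Defensive.

Import GRing.Theory.

Local Open Scope classical_set_scope.
Local Open Scope ring_scope.

(** [bijective] asks for an inverse function; it is obtained classically, from set-theoretic
    bijectivity between the full sets. *)
Lemma inj_surj_bijective (A B : Type) (f : A -> B) :
  injective f -> (forall b, exists a, f a = b) -> bijective f.
Proof.
move=> finj fsurj; rewrite -setTT_bijective; split=> //.
- by move=> x y _ _; apply: finj.
- by move=> b _; have [a <-] := fsurj b; exists a.
Qed.

Lemma subrng_lift (R : rngType) (S : subrng R) (x : R) :
  subrng_set S x -> exists y : S, subrng_val y = x.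
Proof. by move=> Sx; exists (exist _ x (mem_set Sx)). Qed.

Lemma rng_isom_refl (R : rngType) : rng_isom R R.
Proof. by exists id; split=> //; exists id. Qed.

(** First isomorphism theorem. The induced map evaluates [phi] at the chosen representative of a
    coset; by [phi_eq] the choice does not matter, and distinct cosets have distinct images. *)
Lemma rng_first_isom (E Q : rngType) (I : ideal E) (phi : E -> Q) :
  {morph phi : x y / x + y} -> {morph phi : x y / x ** y} ->
  (forall q, exists x, phi x = q) ->
  (forall x, ideal_set I x <-> phi x = 0) ->
  rng_isom (rng_quot I) Q.
Proof.
move=> phiD phiM phi_surj phi_ker.
have phiB x y : phi (x - y) = phi x - phi y.
  by apply: (addIr (phi y)); rewrite -phiD !subrK.
have phi_eq x y : rng_proj I x = rng_proj I y <-> phi x = phi y.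
  split=> [/rng_projP /phi_ker|h].
    by rewrite phiB => /eqP; rewrite subr_eq0 => /eqP.
  by apply/rng_projP/phi_ker; rewrite phiB h subrr.
have phi_repr x : phi (repr (rng_proj I x)) = phi x.
  by apply/phi_eq; rewrite rng_projK.
exists (fun u => phi (repr u)); split.
- apply: inj_surj_bijective => [u v /phi_eq|q]; first by rewrite !rng_projK.
  by have [x <-] := phi_surj q; exists (rng_proj I x).
- move=> u v; rewrite -{1}[u]rng_projK -{1}[v]rng_projK -rng_projD.
  by rewrite phi_repr phiD.
(* A product in the quotient is by definition the class of the product of the representatives, so
   [phi_repr] applies at once. *)
- by move=> u v; rewrite [u ** v]/(rng_proj I _) phi_repr phiM.
Qed.

(** Common shape of the matrices in [T_set] and [m_set], which are instances by conversion; [a] and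
    [b] are free so that the matrix arithmetic does not involve derivations. *)
Definition uptri3 {R : rngType} (f a b g : R) : 'M[R]_3 :=
  mx3 [:: [:: f; a; g]; [:: 0; f; b]; [:: 0; 0; f]].

Section Uptri3.
Variable R : rngType.
Implicit Types f a b g : R.

Lemma uptri3_diag f a b g : uptri3 f a b g ord0 ord0 = f.
Proof. by rewrite mxE. Qed.

Lemma uptri3_corner f a b g : uptri3 f a b g ord0 ord_max = g.
Proof. by rewrite mxE. Qed.

Lemma uptri3_0 : uptri3 0 0 0 0 = 0 :> 'M[R]_3.
Proof. by apply/matrixP => -[[|[|[|//]]] ?] [[|[|[|//]]] ?]; rewrite !mxE. Qed.

Lemma uptri3B f a b g f' a' b' g' :
  uptri3 f a b g - uptri3 f' a' b' g' =
  uptri3 (f - f') (a - a') (b - b') (g - g').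
Proof.
by apply/matrixP => -[[|[|[|//]]] ?] [[|[|[|//]]] ?]; rewrite !mxE //= subr0.
Qed.

(** The entries next to the diagonal take the Leibniz form; the mixed term [a ** b'] occurs only in
    the corner, which is unconstrained in [T_set]. *)
Lemma uptri3M f a b g f' a' b' g' :
  uptri3 f a b g ** uptri3 f' a' b' g' =
  uptri3 (f ** f') (f ** a' + a ** f') (f ** b' + b ** f')
    (f ** g' + a ** b' + g ** f').
Proof.
apply/matrixP => -[[|[|[|//]]] ?] [[|[|[|//]]] ?];
by rewrite !mxE !big_ord_recl big_ord0 !mxE /= ?rmul0r ?rmulr0
  ?addr0 ?add0r ?addrA.
Qed.

End Uptri3.

Section Derivation.
Variables (R : rngType) (S : subrng R) (d : S -> R).
Hypothesis hd : derivation d.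

Lemma derivation0 : d 0 = 0.
Proof. by apply: (addIr (d 0)); rewrite -hd.1 !add0r. Qed.

Lemma derivationB x y : d (x - y) = d x - d y.
Proof. by apply: (addIr (d y)); rewrite -hd.1 !subrK. Qed.

End Derivation.

Section Proposition9.
Variables (R : rngType) (S : subrng R) (d1 d2 : S -> R).
Hypotheses (hd1 : derivation d1) (hd2 : derivation d2).

Lemma T_set_closed : subrng_closed (T_set d1 d2).
Proof.
split.
- by exists 0, 0; rewrite (derivation0 hd1) (derivation0 hd2) -uptri3_0.
- move=> _ _ [f [g ->]] [f' [g' ->]]; exists (f - f'), (g - g').
  by rewrite (derivationB hd1) (derivationB hd2) [LHS]uptri3B.
- move=> _ _ [f [g ->]] [f' [g' ->]]; exists (f ** f').
  (* Any corner is allowed, so its value is left to unification with the product formula. *)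
  by eexists; rewrite [LHS]uptri3M -hd1.2 -hd2.2.
Qed.

Lemma m_set_sub_T_set : m_set R `<=` T_set d1 d2.
Proof.
move=> _ [g ->]; exists 0, g.
by rewrite (derivation0 hd1) (derivation0 hd2).
Qed.

Let T : subrng 'M[R]_3 := Subrng T_set_closed.

Lemma T_valP (A : T) : T_set d1 d2 (val A).
Proof. exact/set_mem/(valP A). Qed.

(* The default [0] is never used: the entry is in [S] by [T_valP]. *)
Definition T_diag (A : T) : S := insubd (0 : S) (val A ord0 ord0).

Lemma T_diagE (A : T) f g :
  val A = uptri3 (subrng_val f) (d1 f) (d2 f) g -> T_diag A = f.
Proof. by rewrite /T_diag => ->; rewrite uptri3_diag valKd. Qed.

Lemma T_valE (A : T) : exists g,
  val A = uptri3 (subrng_val (T_diag A)) (d1 (T_diag A)) (d2 (T_diag A)) g.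
Proof. by have [f [g E]] := T_valP A; exists g; rewrite (T_diagE E). Qed.

Lemma val_T_diag (A : T) : val (T_diag A) = val A ord0 ord0.
Proof. by have [g ->] := T_valE A; rewrite uptri3_diag. Qed.

Lemma T_diagD : {morph T_diag : A B / A + B}.
Proof. by move=> A B; apply: val_inj; rewrite /= !val_T_diag mxE. Qed.

Lemma T_diagM : {morph T_diag : A B / A ** B}.
Proof.
move=> A B; have [[g EA] [h EB]] := (T_valE A, T_valE B); apply: val_inj.
(* The left side is the product of the underlying matrices, to which [val (A ** B)] is
   convertible. *)
have EAB := etrans (f_equal2 rmul EA EB) (uptri3M _ _ _ _ _ _ _ _).
by rewrite val_T_diag [val (A ** B)]EAB uptri3_diag.
Qed.

Lemma T_diag_surj (f : S) : exists A, T_diag A = f.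
Proof.
have hA : T_set d1 d2 (uptri3 (subrng_val f) (d1 f) (d2 f) 0) by exists f, 0.
by have [A /T_diagE] := subrng_lift (S := T) hA; exists A.
Qed.

Lemma T_diag_ker (A : T) : m_set R (subrng_val A) <-> T_diag A = 0.
Proof.
split=> [[g E]|E]; last first.
  have [g] := T_valE A; rewrite E (derivation0 hd1) (derivation0 hd2) => EA.
  by exists g.
by apply: val_inj; rewrite val_T_diag [val A]E mxE.
Qed.

(** By [T_diag_ker] this set is the kernel of [T_diag], and the kernel of a ring morphism is an
    ideal. *)
Lemma m_ideal_closed : ideal_closed [set A : T | m_set R (subrng_val A)].
Proof.
have diag0 : T_diag 0 = 0 by apply: (addIr (T_diag 0)); rewrite -T_diagD !add0r.
split=> [|A B /T_diag_ker hA /T_diag_ker hB|C A /T_diag_ker hA|C A /T_diag_ker hA];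
  apply/T_diag_ker; rewrite ?T_diagM ?hA ?rmulr0 ?rmul0r //.
by apply: (addIr (T_diag B)); rewrite -T_diagD subrK hA hB addr0.
Qed.

Let m : ideal T := Ideal m_ideal_closed.

Lemma m_square0 : ideal_prod m m = [set 0].
Proof.
apply/seteqP; split=> [_ [n [a [b [ha hb ->]]]]|_ ->]; last first.
  (* Conversely, [0] is the empty sum of products. *)
  by exists 0%N, (fun=> 0), (fun=> 0); split=> [[]//|[]//|]; rewrite big_ord0.
apply: big1 => i _; apply: val_inj.
have [g Ea] := ha i; have [h Eb] := hb i.
rewrite [LHS]/(subrng_val (a i) ** subrng_val (b i)) Ea Eb.
(* With only the corners nonzero, every term of the product formula has a zero factor. *)
by rewrite [LHS]uptri3M !rmul0r rmulr0 !addr0 uptri3_0.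
Qed.

(** The isomorphism reads off the corner. The two [val] pass from [m] to [T] and from [T] to
    matrices; surjectivity lifts a corner matrix through the same two stages. *)
Lemma m_corner_isom : zmod_isom m R.
Proof.
have mP (A : m) : m_set R (val (val A)) := set_mem (valP A).
exists (fun A : m => val (val A) ord0 ord_max); last by move=> A B; rewrite mxE.
apply: inj_surj_bijective => [A B|g].
  have [[g EA] [h EB]] := (mP A, mP B).
  by rewrite EA EB !mxE /= => gh; do 2 apply: val_inj; rewrite EA EB gh.
have hm : m_set R (uptri3 0 0 0 g) by exists g.
have [A EA] := subrng_lift (S := T) (m_set_sub_T_set hm).
have [|B EB] := @subrng_lift T m A; first by rewrite /= EA.
by exists B; rewrite [val B]EB [val A]EA uptri3_corner.
Qed.

Lemma T_quot_isom : rng_isom (rng_quot m) S.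
Proof. exact: (@rng_first_isom T S m T_diag T_diagD T_diagM T_diag_surj T_diag_ker). Qed.

End Proposition9.

Theorem proposition9 (R : rngType) (S : subrng R) (d1 d2 : S -> R)
    (hd1 : derivation d1) (hd2 : derivation d2) :
  exists hT : subrng_closed (T_set d1 d2),
    let T : subrng 'M[R]_3 := Subrng hT in
    m_set R `<=` T_set d1 d2 /\
    exists hm : ideal_closed [set A : T | m_set R (subrng_val A)],
      let m : ideal T := Ideal hm in
      [/\ ideal_prod m m = [set 0],
          zmod_isom m R,
          rng_isom (rng_quot m) S &
          ideal_extension T m S].
Proof.
exists (T_set_closed hd1 hd2); split; first exact: m_set_sub_T_set.
exists (m_ideal_closed hd1 hd2) => m; split.
- exact: m_square0.
- exact: m_corner_isom.
- exact: T_quot_isom.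
(* The ideal isomorphic to [m] is [m] itself, through the identity. *)
- by exists m; split; [exact: rng_isom_refl | exact: T_quot_isom].
Qed.
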